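(* Let $f:\mathbb{R}^{m\times n}\to\mathbb{R}$ be twice differentiable and let $g(A,B)=f(AB^\top)$ for $(A,B)\in\mathbb{R}^{m\times r}\times\mathbb{R}^{n\times r}$. Assume that $f$ satisfies $\alpha$-RSC and $\beta$-RSM over an open subset $\mathcal{X}\subseteq\mathbb{R}^{m\times n}_{\mathrm{rank}(r)}$, and that $\beta<2\alpha$. Suppose $\widehat X$ is a global minimizer, i.e. $\mathrm{rank}(\widehat X)\le r$ and $f(\widehat X)=\min_{\mathrm{rank}(X)\le r}f(X)$. If $\widehat X\in\mathcal{X}$ and $\widehat X$ satisfies $$\text{either } \mathrm{rank}(\widehat X)<r,\ \text{ or }\ \mathrm{rank}(\widehat X)=r\ \text{ and }\ \|\nabla f(\widehat X)\|<(2\alpha-\beta)\,\sigma_r(\widehat X),$$ then: (1) $\widehat X$ is the unique fixed point in $\mathcal{X}$ of projected gradient descent (PGD) on $\min_{\mathrm{rank}(X)\le r}f(X)$ at step size $\eta$, for any step size $\frac{1}{2\alpha}<\eta\le\frac1\beta$ in the case that $\mathrm{rank}(\widehat X)<r$, or, in the case $\mathrm{rank}(\widehat X)=r$, for any step size satisfying $$\frac{1}{2\alpha-\frac{\|\nabla f(\widehat X)\|}{\sigma_r(\widehat X)}}<\eta\le\frac1\beta.$$ (2) If $X=AB^\top\in\mathcal{X}$ where $(A,B)$ is a second-order stationary point (SOSP) of $g$, then $X=\widehat X$.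
   Context: Let $m,n,r$ be positive integers with $r\le\min\{m,n\}$. $\|\cdot\|$ is the spectral norm, $\|\cdot\|_F$ the Frobenius norm, $\langle\cdot,\cdot\rangle$ the trace inner product, $\sigma_r(X)$ the $r$-th largest singular value. $\mathbb{R}^{m\times n}_{\mathrm{rank}(r)}$ denotes the set of $m\times n$ matrices of rank $\le r$; ''open subset'' means open relative to this set. $f$ satisfies $\alpha$-RSC (restricted strong convexity) over $\mathcal{X}$ if $f(Y)\ge f(X)+\langle\nabla f(X),Y-X\rangle+\frac\alpha2\|X-Y\|_F^2$ for all $X,Y\in\mathcal{X}$, and $\beta$-RSM (restricted smoothness) over $\mathcal{X}$ if $f(Y)\le f(X)+\langle\nabla f(X),Y-X\rangle+\frac\beta2\|X-Y\|_F^2$ for all $X,Y\in\mathcal{X}$. $X$ is a fixed point of PGD at step size $\eta>0$ if $X\in\arg\min_{\mathrm{rank}(X')\le r}\|X'-(X-\eta\nabla f(X))\|_F$. (PGD iterates $X\leftarrow\mathcal{P}_r(X-\eta\nabla f(X))$ with $\mathcal{P}_r$ the possibly non-unique Frobenius projection onto matrices of rank $\le r$.) $(A,B)$ is a SOSP of $g$ if $\nabla g(A,B)=0$ and $\nabla^2g(A,B)\succeq0$. *)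

(* Defs.v *)
From HB Require Import structures.
From mathcomp Require Export all_boot all_order all_algebra.
From mathcomp Require Export all_classical all_reals all_analysis.
From mathcomp Require Import polyrcf.

Set Implicit Arguments.
Unset Strict Implicit.
Unset Printing Implicit Defensive.

Import Order.TTheory GRing.Theory Num.Theory.
Import numFieldNormedType.Exports.

Local Open Scope classical_set_scope.
Local Open Scope ring_scope.

Definition mxdot (R : realType) (m n : nat) (X Y : 'M[R]_(m, n)) : R :=
  \tr (X^T *m Y).

(* The norm [`|X|] of the library is the max-entry norm; it is used here only
   for the topology and for differentiability, where the choice of norm on a
   finite-dimensional space is immaterial. *)
Definition frob_norm (R : realType) (m n : nat) (X : 'M[R]_(m, n)) : R :=
  Num.sqrt (mxdot X X).

(* On a column vector, [frob_norm] is the Euclidean norm. *)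
Definition spectral_norm (R : realType) (m n : nat) (X : 'M[R]_(m, n)) : R :=
  sup [set frob_norm (X *m v) | v in [set v : 'cV[R]_n | frob_norm v <= 1]].

(* The square roots of the eigenvalues of X^T X, repeated according to their
   multiplicity as roots of the characteristic polynomial, in nonincreasing
   order. There are n of them: when m < n, this only appends n - m zeros to the
   usual list of length min(m, n). *)
Definition singular_values (R : realType) (m n : nat) (X : 'M[R]_(m, n)) :
    seq R :=
  let p := char_poly (X^T *m X) in
  sort (fun x y => y <= x)
    (flatten [seq nseq (mup x p) (Num.sqrt x) | x <- rootsR p]).

(* The k-th largest singular value, k being counted from 1. *)
Definition singular_value (R : realType) (m n : nat) (k : nat)
    (X : 'M[R]_(m, n)) : R :=
  nth 0 (singular_values X) k.-1.

Definition grad (R : realType) (m n : nat) (f : 'M[R]_(m, n) -> R)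
    (X : 'M[R]_(m, n)) : 'M[R]_(m, n) :=
  \matrix_(i, j) 'd f X (delta_mx i j).

(* Twice Frechet differentiable on the whole space: since the entries of
   [grad f X] are the coordinates of ['d f X], the second condition says that
   X |-> 'd f X is differentiable. *)
Definition twice_differentiable (R : realType) (m n : nat)
    (f : 'M[R]_(m, n) -> R) : Prop :=
  forall X, differentiable f X /\ differentiable (grad f) X.

Definition rank_le_set (R : realType) (m n r : nat) : set 'M[R]_(m, n) :=
  [set X | (\rank X <= r)%N].

Definition relatively_open (T : topologicalType) (D S : set T) : Prop :=
  exists U : set T, open U /\ S = U `&` D.

Definition RSC (R : realType) (m n : nat) (alpha : R)
    (f : 'M[R]_(m, n) -> R) (S : set 'M[R]_(m, n)) : Prop :=
  forall X Y, S X -> S Y ->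
    f Y >= f X + mxdot (grad f X) (Y - X) + alpha / 2 * frob_norm (X - Y) ^+ 2.

Definition RSM (R : realType) (m n : nat) (beta : R)
    (f : 'M[R]_(m, n) -> R) (S : set 'M[R]_(m, n)) : Prop :=
  forall X Y, S X -> S Y ->
    f Y <= f X + mxdot (grad f X) (Y - X) + beta / 2 * frob_norm (X - Y) ^+ 2.

Definition is_argmin (R : realType) (T : Type) (h : T -> R) (D : set T)
    (x : T) : Prop :=
  D x /\ forall y, D y -> h x <= h y.

Definition pgd_fixed_point (R : realType) (m n r : nat)
    (f : 'M[R]_(m, n) -> R) (eta : R) (X : 'M[R]_(m, n)) : Prop :=
  is_argmin (fun X' => frob_norm (X' - (X - eta *: grad f X)))
    (@rank_le_set R m n r) X.

Definition factored (R : realType) (m n r : nat) (f : 'M[R]_(m, n) -> R)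
    (AB : 'M[R]_(m, r) * 'M[R]_(n, r)) : R :=
  f (AB.1 *m AB.2^T).

(* The gradient of a function on a product of two matrix spaces, for the inner
   product <A, A'> + <B, B'>. *)
Definition grad2 (R : realType) (m n r : nat)
    (g : 'M[R]_(m, r) * 'M[R]_(n, r) -> R)
    (AB : 'M[R]_(m, r) * 'M[R]_(n, r)) : 'M[R]_(m, r) * 'M[R]_(n, r) :=
  (\matrix_(i, j) 'd g AB (delta_mx i j, 0),
   \matrix_(i, j) 'd g AB (0, delta_mx i j)).

(* The Hessian, as the linear operator UV |-> D(grad g)(AB)[UV]. *)
Definition hess2 (R : realType) (m n r : nat)
    (g : 'M[R]_(m, r) * 'M[R]_(n, r) -> R)
    (AB UV : 'M[R]_(m, r) * 'M[R]_(n, r)) : 'M[R]_(m, r) * 'M[R]_(n, r) :=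
  'd (grad2 g) AB UV.

Definition SOSP (R : realType) (m n r : nat)
    (g : 'M[R]_(m, r) * 'M[R]_(n, r) -> R)
    (AB : 'M[R]_(m, r) * 'M[R]_(n, r)) : Prop :=
  grad2 g AB = 0 /\
  forall UV : 'M[R]_(m, r) * 'M[R]_(n, r),
    0 <= mxdot UV.1 (hess2 g AB UV).1 + mxdot UV.2 (hess2 g AB UV).2.

(* Main.v *)
(* RSM on a neighbourhood of [X] in the rank-constrained set turns the
   second-order conditions at a SOSP (A, B) with X = A B^T into
     2 <H, U V^T> + beta |A V^T + U B^T|^2 >= 0  for all U, V,
   where H is the gradient of f at X. If rank X < r this forces H = 0; if
   rank X = r, testing it on rank-one U, V built from a least singular vector
   of X gives ||H|| <= beta sigma_r(X). In both cases an Eckart-Young argument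
   shows that X is a fixed point of PGD at step size 1/beta, so (2) follows
   from the uniqueness in (1).

   For uniqueness, add the RSC inequalities at X and Xhat: the two gradient
   terms are bounded below by the fixed-point inequality at X and by the
   Eckart-Young inequality
     2 <G, X - Xhat> >= - (||G|| / sigma_r(Xhat)) |X - Xhat|^2
   at Xhat, and the resulting coefficient of |X - Xhat|^2 is positive exactly
   when the step size exceeds the stated lower bound. *)
From HB Require Import structures.
Require Import Defs.
From mathcomp Require Import polyrcf ring lra.

Set Implicit Arguments.
Unset Strict Implicit.
Unset Printing Implicit Defensive.

Import Order.TTheory GRing.Theory Num.Theory.
Import numFieldNormedType.Exports.

Local Open Scope classical_set_scope.
Local Open Scope ring_scope.

(** * The trace inner product, the Frobenius norm and the spectral norm *)

Section FrobeniusInnerProduct.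
Context {R : realType}.

Lemma mxdotE m n (X Y : 'M[R]_(m, n)) :
  mxdot X Y = \sum_i \sum_j X i j * Y i j.
Proof.
rewrite /mxdot /mxtrace exchange_big; apply: eq_bigr => j _.
by rewrite mxE; apply: eq_bigr => i _; rewrite mxE.
Qed.

Lemma mxdotC m n (X Y : 'M[R]_(m, n)) : mxdot X Y = mxdot Y X.
Proof. by rewrite /mxdot -mxtrace_tr trmx_mul trmxK. Qed.

Lemma mxdotDr m n (X Y Z : 'M[R]_(m, n)) :
  mxdot X (Y + Z) = mxdot X Y + mxdot X Z.
Proof. by rewrite /mxdot mulmxDr mxtraceD. Qed.

Lemma mxdotZr m n a (X Y : 'M[R]_(m, n)) : mxdot X (a *: Y) = a * mxdot X Y.
Proof. by rewrite /mxdot -scalemxAr mxtraceZ. Qed.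

Lemma mxdotNr m n (X Y : 'M[R]_(m, n)) : mxdot X (- Y) = - mxdot X Y.
Proof. by rewrite -scaleN1r mxdotZr mulN1r. Qed.

Lemma mxdotDl m n (X Y Z : 'M[R]_(m, n)) :
  mxdot (X + Y) Z = mxdot X Z + mxdot Y Z.
Proof. by rewrite mxdotC mxdotDr !(mxdotC Z). Qed.

Lemma mxdotZl m n a (X Y : 'M[R]_(m, n)) : mxdot (a *: X) Y = a * mxdot X Y.
Proof. by rewrite mxdotC mxdotZr mxdotC. Qed.

Lemma mxdotNl m n (X Y : 'M[R]_(m, n)) : mxdot (- X) Y = - mxdot X Y.
Proof. by rewrite mxdotC mxdotNr mxdotC. Qed.

Lemma mxdotBl m n (X Y Z : 'M[R]_(m, n)) :
  mxdot (X - Y) Z = mxdot X Z - mxdot Y Z.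
Proof. by rewrite mxdotDl mxdotNl. Qed.

Lemma mxdot0r m n (X : 'M[R]_(m, n)) : mxdot X 0 = 0.
Proof. by rewrite /mxdot mulmx0 mxtrace0. Qed.

Lemma mxdot_mull m n p (A : 'M[R]_(m, p)) (X : 'M[R]_(p, n)) Y :
  mxdot (A *m X) Y = mxdot X (A^T *m Y).
Proof. by rewrite /mxdot trmx_mul mulmxA. Qed.

Lemma mxdot_mulr m n p (X : 'M[R]_(m, p)) (A : 'M[R]_(p, n)) Y :
  mxdot (X *m A) Y = mxdot X (Y *m A^T).
Proof. by rewrite /mxdot trmx_mul -mulmxA mxtrace_mulC !mulmxA. Qed.

Lemma mxdot_tr m n (X Y : 'M[R]_(m, n)) : mxdot X^T Y^T = mxdot X Y.
Proof. by rewrite mxdotC /mxdot trmxK mxtrace_mulC. Qed.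

Lemma mxdot_ge0 m n (X : 'M[R]_(m, n)) : 0 <= mxdot X X.
Proof. by rewrite mxdotE; do 2!apply: sumr_ge0 => ? _; rewrite -expr2 sqr_ge0. Qed.

Lemma sqr_entry_le m n (X : 'M[R]_(m, n)) i j : X i j ^+ 2 <= mxdot X X.
Proof.
rewrite mxdotE (bigD1 i)//= (bigD1 j)//= -expr2 -addrA lerDl addr_ge0 //.
  by apply: sumr_ge0 => ? _; rewrite -expr2 sqr_ge0.
by do 2!apply: sumr_ge0 => ? _; rewrite -expr2 sqr_ge0.
Qed.

Lemma mxdot_eq0 m n (X : 'M[R]_(m, n)) : mxdot X X = 0 -> X = 0.
Proof.
move=> X0; apply/matrixP => i j; rewrite mxE; apply/eqP.
by rewrite -sqrf_eq0 eq_le sqr_ge0 -X0 sqr_entry_le.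
Qed.

Lemma mxdot_gt0 m n (X : 'M[R]_(m, n)) : X != 0 -> 0 < mxdot X X.
Proof.
move=> X0; rewrite lt0r mxdot_ge0 andbT.
by apply: contraNneq X0 => /mxdot_eq0 ->.
Qed.

Lemma mxdotDD m n (X Y : 'M[R]_(m, n)) :
  mxdot (X + Y) (X + Y) = mxdot X X + 2 * mxdot X Y + mxdot Y Y.
Proof. by rewrite mxdotDl !mxdotDr (mxdotC Y X); ring. Qed.

Lemma mxdotBB m n (X Y : 'M[R]_(m, n)) :
  mxdot (X - Y) (X - Y) = mxdot X X - 2 * mxdot X Y + mxdot Y Y.
Proof. by rewrite mxdotDD mxdotNl !mxdotNr opprK mulrN. Qed.

Lemma mxdot_CauchySchwarz m n (X Y : 'M[R]_(m, n)) :
  mxdot X Y ^+ 2 <= mxdot X X * mxdot Y Y.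
Proof.
have [->|Y0] := eqVneq Y 0; first by rewrite !mxdot0r expr0n mulr0.
have YY := mxdot_gt0 Y0.
have := mxdot_ge0 (mxdot Y Y *: X - mxdot X Y *: Y).
rewrite mxdotBB !(mxdotZl, mxdotZr).
set a := mxdot X X; set b := mxdot X Y; set c := mxdot Y Y in YY *.
have -> : c * (c * a) - 2 * (c * (b * b)) + b * (b * c) = c * (a * c - b ^+ 2).
  by ring.
by rewrite pmulr_rge0 // subr_ge0.
Qed.

Lemma frob_normK m n (X : 'M[R]_(m, n)) : frob_norm X ^+ 2 = mxdot X X.
Proof. by rewrite /frob_norm sqr_sqrtr ?mxdot_ge0. Qed.

Lemma mxdot_cV n (u v : 'cV[R]_n) : u^T *m v = (mxdot u v)%:M.
Proof. by rewrite [LHS]mx11_scalar /mxdot trace_mx11. Qed.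

Lemma mxdot_outer m n (a c : 'cV[R]_m) (b d : 'cV[R]_n) :
  mxdot (a *m b^T) (c *m d^T) = mxdot a c * mxdot b d.
Proof.
rewrite mxdot_mulr trmxK -mulmxA mxdot_cV mul_mx_scalar mxdotZr.
by rewrite (mxdotC d) mulrC.
Qed.

Lemma mxdot_col m n p (A : 'M[R]_(m, n)) (M : 'M[R]_(n, p)) :
  mxdot (A *m M) (A *m M) = \sum_j mxdot (A *m col j M) (A *m col j M).
Proof.
rewrite mxdotE exchange_big; apply: eq_bigr => j _.
rewrite mxdotE; apply: eq_bigr => i _; rewrite big_ord1.
suff -> : (A *m col j M) i 0 = (A *m M) i j by [].
by rewrite !mxE; apply: eq_bigr => k _; rewrite mxE.
Qed.

(** The squared Frobenius norm of a product is a sum over the columns of the right factor. In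
    [eckart_young] this turns bounds on vectors into bounds on traces. *)
Lemma ler_mxdot_mul m m' n p (A : 'M[R]_(m, n)) (B : 'M[R]_(m', n)) a b :
  (forall v : 'cV[R]_n,
    a * mxdot (A *m v) (A *m v) <= b * mxdot (B *m v) (B *m v)) ->
  forall M : 'M[R]_(n, p),
    a * mxdot (A *m M) (A *m M) <= b * mxdot (B *m M) (B *m M).
Proof.
by move=> h M; rewrite !mxdot_col !mulr_sumr; apply: ler_sum => j _; apply: h.
Qed.

(** Cauchy-Schwarz for [G] against the rank-one matrix [G v v^T]; it makes the supremum in
    [spectral_norm] finite. *)
Lemma mxdot_mulmx_le m n (G : 'M[R]_(m, n)) (v : 'cV[R]_n) :
  mxdot (G *m v) (G *m v) <= mxdot G G * mxdot v v.
Proof.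
have [->|] := eqVneq (G *m v) 0; first by rewrite mxdot0r mulr_ge0 ?mxdot_ge0.
move=> /mxdot_gt0 Gv; rewrite -(ler_pM2r Gv).
have := mxdot_CauchySchwarz G ((G *m v) *m v^T).
have {1}-> : mxdot G (G *m v *m v^T) = mxdot (G *m v) (G *m v).
  by rewrite mxdot_mulr.
by rewrite mxdot_outer expr2 -mulrA [mxdot v v * _]mulrC.
Qed.

Lemma spectral_norm_has_sup m n (G : 'M[R]_(m, n)) :
  has_sup [set frob_norm (G *m v) | v in [set v : 'cV[R]_n | frob_norm v <= 1]].
Proof.
split.
  by exists (frob_norm (G *m (0 : 'cV[R]_n))), 0 => //=; rewrite /frob_norm mxdot0r sqrtr0.
exists (Num.sqrt (mxdot G G)) => _ [v /= v1 <-].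
rewrite ler_wsqrtr // (le_trans (mxdot_mulmx_le _ _)) //.
by rewrite ler_piMr ?mxdot_ge0 // -frob_normK expr_le1 ?sqrtr_ge0.
Qed.

Lemma spectral_norm_ub m n (G : 'M[R]_(m, n)) (v : 'cV[R]_n) :
  frob_norm v <= 1 -> frob_norm (G *m v) <= spectral_norm G.
Proof.
by move=> v1; apply: sup_upper_bound; [exact: spectral_norm_has_sup|exists v].
Qed.

Lemma spectral_norm_ge0 m n (G : 'M[R]_(m, n)) : 0 <= spectral_norm G.
Proof.
apply: le_trans (@spectral_norm_ub _ _ G 0 _); rewrite /frob_norm ?sqrtr_ge0 //.
by rewrite mxdot0r sqrtr0.
Qed.

Lemma spectral_norm_mul m n (G : 'M[R]_(m, n)) (v : 'cV[R]_n) :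
  mxdot (G *m v) (G *m v) <= spectral_norm G ^+ 2 * mxdot v v.
Proof.
have [->|v0] := eqVneq v 0; first by rewrite mulmx0 !mxdot0r mulr0.
have vv := mxdot_gt0 v0; have nv : 0 < frob_norm v by rewrite sqrtr_gt0.
have := @spectral_norm_ub _ _ G ((frob_norm v)^-1 *: v).
have e (p : nat) (w : 'cV[R]_p) : frob_norm ((frob_norm v)^-1 *: w) ^+ 2
   = mxdot w w / mxdot v v.
  by rewrite frob_normK mxdotZl mxdotZr mulrA -expr2 exprVn frob_normK mulrC.
have -> : frob_norm ((frob_norm v)^-1 *: v) <= 1.
  by rewrite -(@expr_le1 _ 2) ?sqrtr_ge0 // e divff ?gt_eqF.
move=> /(_ isT); rewrite -scalemxAr => h.
rewrite -ler_pdivrMr // -e.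
by rewrite lerXn2r ?nnegrE ?sqrtr_ge0 ?spectral_norm_ge0.
Qed.

End FrobeniusInnerProduct.

(** * Orthogonal projectors on row spaces and the Eckart-Young inequality *)

Section EckartYoung.
Context {R : realType}.

Lemma gram_unitmx m n (B : 'M[R]_(m, n)) : row_free B -> B *m B^T \in unitmx.
Proof.
move=> /row_freeP[C BC]; rewrite -row_free_unit -kermx_eq0.
apply/eqP; set K := kermx _; have : K *m (B *m B^T) = 0 by exact: mulmx_ker.
move=> KB; suff KB0 : K *m B = 0 by rewrite -[K]mulmx1 -BC mulmxA KB0 mul0mx.
apply: mxdot_eq0; rewrite mxdot_mulr -mulmxA KB.
by rewrite mxdot0r.
Qed.

(** With [B] a basis of the row space, the projector is [B^T (B B^T)^-1 B]. The factorisation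
    [Q = M *m Y] records that its rows lie in the row space of [Y], so [G Y^T = 0] implies
    [G Q = 0]. *)
Lemma row_space_projector m n (Y : 'M[R]_(m, n)) :
  exists Q : 'M[R]_n, [/\ Q^T = Q, Q *m Q = Q, Y *m Q = Y,
    \tr Q = (\rank Y)%:R & exists M, Q = M *m Y].
Proof.
move: (row_base Y) (row_base_free Y) (eq_row_base Y) => B freeB eqB.
pose S := B *m B^T; have uS : S \in unitmx by exact: gram_unitmx.
have symS : S^T = S by rewrite trmx_mul trmxK.
have [K YK] : exists K, Y = K *m B by apply/submxP; rewrite eqB.
have [L BL] : exists L, B = L *m Y by apply/submxP; rewrite eqB.
exists (B^T *m invmx S *m B); split.
- by rewrite !trmx_mul trmxK trmx_inv symS mulmxA.
- rewrite !mulmxA -[_ *m B *m B^T]mulmxA -/S.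
  by rewrite -[_ *m S]mulmxA mulVmx // mulmx1.
- by rewrite {1}YK !mulmxA -[K *m B *m B^T]mulmxA -/S mulmxK // -YK.
- by rewrite mxtrace_mulC !mulmxA -/S mulmxV // mxtrace1.
- by exists (B^T *m invmx S *m L); rewrite {2}BL !mulmxA.
Qed.

Lemma mxdot_projector_split m n (Z : 'M[R]_(m, n)) (Q : 'M[R]_n) :
  Q^T = Q -> Q *m Q = Q ->
  mxdot Z Z = mxdot (Z *m Q) (Z *m Q)
    + mxdot (Z *m (1%:M - Q)) (Z *m (1%:M - Q)).
Proof.
move=> symQ idQ; rewrite mulmxBr mulmx1 mxdotBB.
by rewrite mxdot_mulr symQ -mulmxA idQ; ring.
Qed.

Lemma mxdot_projectors n (P Q : 'M[R]_n) :
  P^T = P -> P *m P = P -> Q^T = Q -> Q *m Q = Q ->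
  mxdot (P *m Q) (P *m Q) = \tr (P *m Q).
Proof.
by move=> symP idP symQ idQ; rewrite mxdot_mulr symQ -mulmxA idQ /mxdot symP mulmxA idP.
Qed.

(* [X] is a closest matrix of rank at most [\rank X] to [Z = X - eta *: G]. A
   matrix [Y] with row-space projector [Q] is at squared distance at least
   |Z (1 - Q)|^2 from [Z], and traces of products of [Q] with the row-space
   projector [P] of [X] bound this from below by |eta G|^2. Here [tau] and
   [gam] stand for the squares of the least nonzero singular value of [X] and
   of the spectral norm of [G]. *)
Lemma eckart_young m n (X G Y : 'M[R]_(m, n)) (P : 'M[R]_n) (eta gam tau : R) :
  P^T = P -> P *m P = P -> \tr P = (\rank X)%:R -> G *m P = 0 ->
  G^T *m X = 0 ->
  (forall v : 'cV[R]_n, tau * mxdot (P *m v) (P *m v) <= mxdot (X *m v) (X *m v)) ->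
  (forall v : 'cV[R]_n, mxdot (G *m v) (G *m v) <= gam * mxdot v v) ->
  0 <= gam -> eta ^+ 2 * gam <= tau -> (\rank Y <= \rank X)%N ->
  0 <= 2 * eta * mxdot G (Y - X) + mxdot (Y - X) (Y - X).
Proof.
move=> symP idP trP GP GX hX hG gam0 egt rYX.
have [Q [symQ idQ YQ trQ _]] := row_space_projector Y.
have trPQ : \tr (P *m (1%:M - Q)) = (\rank X)%:R - \tr (P *m Q).
  by rewrite mulmxBr mulmx1 raddfB /= trP.
have trPQ' : \tr ((1%:M - P) *m Q) = (\rank Y)%:R - \tr (P *m Q).
  by rewrite mulmxBl mul1mx raddfB /= trQ.
have compl (S : 'M[R]_n) : S^T = S -> S *m S = S ->
    (1%:M - S)^T = 1%:M - S /\ (1%:M - S) *m (1%:M - S) = 1%:M - S.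
  move=> symS idS; split; first by rewrite raddfB /= trmx1 symS.
  by rewrite mulmxBl mul1mx mulmxBr mulmx1 idS subrr subr0.
have [symP' idP'] := compl _ symP idP; have [symQ' idQ'] := compl _ symQ idQ.
have hPQ : 0 <= \tr (P *m (1%:M - Q)).
  by rewrite -mxdot_projectors ?mxdot_ge0.
have h1 : tau * \tr (P *m (1%:M - Q)) <= mxdot (X *m (1%:M - Q)) (X *m (1%:M - Q)).
  rewrite -mxdot_projectors // -[leRHS]mul1r.
  by apply: ler_mxdot_mul => v; rewrite mul1r.
have h2 : mxdot (G *m Q) (G *m Q) <= gam * \tr ((1%:M - P) *m Q).
  have GP' : G *m Q = G *m ((1%:M - P) *m Q).
    by rewrite mulmxA mulmxBr mulmx1 GP subr0.
  rewrite -mxdot_projectors // GP' -[leLHS]mul1r -[(1%:M - P) *m Q]mul1mx.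
  rewrite [in leLHS]mul1mx.
  by apply: ler_mxdot_mul => v; rewrite mul1r mul1mx.
(* The rank constraint on [Y] enters here: the two traces are [\rank Y] and [\rank X] minus the same
   number [\tr (P *m Q)]. *)
have h3 : \tr ((1%:M - P) *m Q) <= \tr (P *m (1%:M - Q)).
  by rewrite trPQ trPQ' lerD2r ler_nat.
have h4 : mxdot (G *m Q) (G *m Q) <= gam * \tr (P *m (1%:M - Q)).
  by apply: le_trans h2 _; rewrite ler_wpM2l.
have h5 : eta ^+ 2 * mxdot (G *m Q) (G *m Q)
    <= mxdot (X *m (1%:M - Q)) (X *m (1%:M - Q)).
  apply: le_trans h1; apply: (@le_trans _ _ (eta ^+ 2 * gam * \tr (P *m (1%:M - Q)))).
    by rewrite -mulrA ler_wpM2l ?sqr_ge0.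
  by rewrite ler_wpM2r.
have XGdot k (A B : 'M[R]_(n, k)) : mxdot (X *m A) (G *m B) = 0.
  by rewrite mxdotC mxdot_mull mulmxA GX mul0mx mxdot0r.
pose Z := Y - (X - eta *: G).
(* As [Y (1 - Q) = 0], this part of [Z] comes from [X] and [G] alone, whose contributions are
   orthogonal because [G^T X = 0]. *)
have ZQ : Z *m (1%:M - Q) = - (X - eta *: G) *m (1%:M - Q).
  by rewrite mulmxDl [Y *m _]mulmxBr mulmx1 YQ subrr add0r.
have h6 : mxdot (X *m (1%:M - Q)) (X *m (1%:M - Q))
   + eta ^+ 2 * mxdot (G *m (1%:M - Q)) (G *m (1%:M - Q)) <= mxdot Z Z.
  rewrite (mxdot_projector_split Z symQ idQ) ZQ mulNmx mxdotNl mxdotNr opprK.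
  have := mxdot_ge0 (Z *m Q); move: (mxdot (Z *m Q) _) => c c0.
  rewrite mulmxBl mxdotBB -scalemxAl !mxdotZr mxdotZl XGdot.
  by rewrite !mulr0 subr0 mulrA -expr2 lerDr.
have h7 := mxdot_projector_split G symQ idQ.
have h8 : eta ^+ 2 * mxdot G G <= mxdot Z Z.
  by apply: le_trans h6; rewrite h7 mulrDr lerD2r.
have ZE : Z = (Y - X) + eta *: G by rewrite /Z opprB addrCA addrC.
move: h8; rewrite ZE mxdotDD mxdotZl !mxdotZr (mxdotC (Y - X) G).
by move=> h8; lra.
Qed.

End EckartYoung.

(** * Limits of matrix products and of the inner product *)

Section MatrixContinuity.
Context {R : realType}.

Lemma cvg_mx T (F : set_system T) {FF : Filter F} m n
    (f : T -> 'M[R]_(m, n)) (L : 'M[R]_(m, n)) :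
  (forall i j, f t i j @[t --> F] --> L i j) -> f t @[t --> F] --> L.
Proof.
move=> fL; apply/cvgrPdist_le => e e0; near=> t.
rewrite /Num.Def.normr/= mx_normrE (bigmax_le _ (ltW e0))//= => i _.
rewrite !mxE; move: i; near: t; apply: filter_forall => i.
exact: ((cvgrPdist_le _ _).1 (fL i.1 i.2)).
Unshelve. all: by end_near. Qed.

Lemma cvg_coord T (F : set_system T) {FF : Filter F} m n
    (f : T -> 'M[R]_(m, n)) (L : 'M[R]_(m, n)) i j :
  f t @[t --> F] --> L -> f t i j @[t --> F] --> L i j.
Proof. by move=> fL; exact: cvg_comp fL (@coord_continuous _ _ _ i j L). Qed.

Lemma cvg_mulmx T (F : set_system T) {FF : Filter F} m n p
    (f : T -> 'M[R]_(m, n)) (g : T -> 'M[R]_(n, p))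
    (L : 'M[R]_(m, n)) (M : 'M[R]_(n, p)) :
  f t @[t --> F] --> L -> g t @[t --> F] --> M ->
  f t *m g t @[t --> F] --> L *m M.
Proof.
move=> fL gM; apply: cvg_mx => i j; rewrite mxE; under eq_cvg do rewrite mxE.
apply: cvg_big => [|k _]; first exact: add_continuous.
by apply: cvgM; apply: cvg_coord.
Qed.

Lemma cvg_mxdot T (F : set_system T) {FF : Filter F} m n
    (f g : T -> 'M[R]_(m, n)) (L M : 'M[R]_(m, n)) :
  f t @[t --> F] --> L -> g t @[t --> F] --> M ->
  mxdot (f t) (g t) @[t --> F] --> mxdot L M.
Proof.
move=> fL gM; rewrite mxdotE; under eq_cvg do rewrite mxdotE.
apply: cvg_big => [|i _]; first exact: add_continuous.
apply: cvg_big => [|j _]; first exact: add_continuous.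
by apply: cvgM; apply: cvg_coord.
Qed.

End MatrixContinuity.

(** * The least nonzero singular value, as a minimum of the Rayleigh quotient *)

Section Rayleigh.
Context {R : realType}.

Lemma quadratic_ge0_linear_coef (b c : R) :
  (forall t, 0 <= t * b + t ^+ 2 * c) -> b = 0.
Proof.
move=> h; apply/eqP; apply: contraT => b0.
have d0 : 0 < 1 + c ^+ 2 by rewrite ltr_pwDl ?sqr_ge0.
have b2 : 0 < b ^+ 2 by rewrite lt0r sqrf_eq0 b0 sqr_ge0.
(* At this [t] the quadratic is negative whatever the sign of [c], since [1 - c + c^2 > 0]. *)
have := h (- b / (1 + c ^+ 2)).
have -> : - b / (1 + c ^+ 2) * b + (- b / (1 + c ^+ 2)) ^+ 2 * c
   = - (b ^+ 2 * (1 - c + c ^+ 2) / (1 + c ^+ 2) ^+ 2).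
  by field; rewrite gt_eqF.
rewrite oppr_ge0 leNgt => /negP[].
rewrite divr_gt0 ?exprn_gt0 // mulr_gt0 //.
have : 0 <= (1 - c) ^+ 2 by exact: sqr_ge0.
by move=> hc; nra.
Qed.

Lemma compact_unit_fixed n (P : 'M[R]_n) :
  compact [set u : 'rV[R]_n | mxdot u u = 1 /\ u *m P = u].
Proof.
apply: bounded_closed_compact.
  exists 1; split=> // x x1 u /= [u1 _].
  rewrite /Num.Def.normr/= mx_normrE (bigmax_le _ (le_trans ler01 (ltW x1)))//=.
  move=> [i j] _ /=; apply: le_trans (ltW x1).
  by rewrite -(@expr_le1 _ 2) ?normr_ge0 // real_normK ?num_real // -u1 sqr_entry_le.
apply: closedI.
  apply: (@closed_comp _ _ (fun u : 'rV[R]_n => mxdot u u) [set 1]).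
    by move=> u _; exact: (cvg_mxdot (@cvg_id _ (nbhs u)) (@cvg_id _ (nbhs u))).
  exact: closed_eq.
suff -> : (fun u : 'rV[R]_n => u *m P = u) =
    (fun u => mxdot (u *m P - u) (u *m P - u)) @^-1` [set 0].
  apply: closed_comp; last exact: closed_eq.
  have cu (u : 'rV[R]_n) : (v *m P - v) @[v --> u] --> u *m P - u.
    by apply: cvgB (@cvg_id _ (nbhs u)); apply: (cvg_mulmx (f := id) (g := fun=> P));
      [exact: cvg_id|exact: cvg_cst].
  by move=> u _; exact: (cvg_mxdot (cu u) (cu u)).
apply/seteqP; split=> u /=; first by move=> ->; rewrite subrr mxdot0r.
by move=> /mxdot_eq0/eqP; rewrite subr_eq0 => /eqP.
Qed.

(** By compactness [|X u|^2] attains a minimum [tau] on the unit vectors of the row space. The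
    first-order condition makes the minimiser an eigenvector of [X^T X], and [tau > 0] because [X]
    is injective on its row space. *)
Lemma rayleigh_min m n (X : 'M[R]_(m, n)) (P : 'M[R]_n) :
  P^T = P -> P *m P = P -> X *m P = X -> (exists M, P = M *m X) -> X != 0 ->
  exists (v : 'cV[R]_n) (tau : R), [/\ mxdot v v = 1, 0 < tau,
    X^T *m (X *m v) = tau *: v &
    forall w : 'cV[R]_n, tau * mxdot (P *m w) (P *m w) <= mxdot (X *m w) (X *m w)].
Proof.
move=> symP idP XP [M PM] X0.
pose A := [set u : 'rV[R]_n | mxdot u u = 1 /\ u *m P = u].
have normalize (u : 'rV[R]_n) : u != 0 -> u *m P = u ->
    A ((Num.sqrt (mxdot u u))^-1 *: u).
  move=> /mxdot_gt0 uu uP; split; last by rewrite -scalemxAl uP.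
  rewrite mxdotZl mxdotZr mulrA -expr2 exprVn sqr_sqrtr ?ltW //.
  by rewrite mulVf ?gt_eqF.
have A0 : A !=set0.
  have P0 : P != 0 by apply: contraNneq X0 => P0; rewrite -XP P0 mulmx0.
  have [i Pi] : exists i, row i P != 0.
    apply/existsP; apply: contraNT P0; rewrite negb_exists => /forallP h.
    by apply/eqP/row_matrixP => i; rewrite row0; apply/eqP; rewrite -[_ == _]negbK.
  by eexists; apply: (normalize _ Pi); rewrite -row_mul idP.
have cf : {within A, continuous (fun u : 'rV[R]_n => mxdot (u *m X^T) (u *m X^T))}.
  apply: continuous_subspaceT => u.
  have cu : (v *m X^T) @[v --> u] --> u *m X^T.
    exact: (cvg_mulmx (f := id) (g := fun=> X^T) (@cvg_id _ (nbhs u))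
      (@cvg_cst _ _ _ _ _)).
  exact: (cvg_mxdot cu cu).
have [u uA umin] := compact_EVT_min A0 (@compact_unit_fixed n P) cf.
move: uA; rewrite inE => -[u1 uP].
set tau := mxdot (u *m X^T) (u *m X^T) in umin.
have PX : P *m X^T = X^T by rewrite -{1}symP -trmx_mul XP.
have min (w : 'rV[R]_n) :
    0 <= mxdot (w *m X^T) (w *m X^T) - tau * mxdot (w *m P) (w *m P).
  rewrite subr_ge0 -{1 2}PX !mulmxA; set z := w *m P.
  have [->|z0] := eqVneq z 0; first by rewrite mul0mx !mxdot0r mulr0.
  have zP : z *m P = z by rewrite -mulmxA idP.
  have := umin _ (mem_set (normalize _ z0 zP)).
  rewrite -scalemxAl mxdotZl mxdotZr mulrA -expr2 exprVn sqr_sqrtr ?mxdot_ge0 //.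
  by rewrite ler_pdivlMl ?mxdot_gt0 // mulrC.
(* The form in [min] is nonnegative and vanishes at [u], so its polarisation against [u] vanishes in
   every direction [w]. *)
have lin (w : 'rV[R]_n) :
    mxdot (u *m X^T) (w *m X^T) - tau * mxdot (u *m P) (w *m P) = 0.
  apply: (@quadratic_ge0_linear_coef _
    ((mxdot (w *m X^T) (w *m X^T) - tau * mxdot (w *m P) (w *m P)) / 2)) => t.
  have := min (u + t *: w); rewrite !mulmxDl -!scalemxAl !mxdotDD !mxdotZr !mxdotZl.
  rewrite -/tau uP u1.
  by move=> h; lra.
exists u^T, tau; split; first by rewrite mxdot_tr.
- rewrite lt0r mxdot_ge0 andbT; apply/eqP => /mxdot_eq0 uX.
  move: u1; rewrite -uP -symP PM trmx_mul mulmxA uX mul0mx mxdot0r => /eqP.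
  by rewrite eq_sym oner_eq0.
- apply: trmx_inj; rewrite !trmx_mul !trmxK linearZ /= trmxK.
  apply/eqP; rewrite -subr_eq0; apply/eqP.
  (* Testing [lin] on the residual [d] itself gives [|d|^2 = 0]. *)
  apply: mxdot_eq0; set d := _ - _; rewrite -[RHS](lin d) {1}/d mxdotBl mxdotZl.
  rewrite (mxdot_mulr _ X) uP; congr (_ - tau * _).
  by rewrite [RHS]mxdotC mxdot_mulr symP uP mxdotC.
- move=> w; have := min w^T.
  by rewrite -{1 2}symP -!trmx_mul !mxdot_tr subr_ge0.
Qed.
End Rayleigh.

(** * Counting singular values through the characteristic polynomial of [X^T X] *)

Section SingularValues.
Context {R : realType}.

(** The block matrix with rows [('X, A)] and [(B, 1)] becomes block triangular under two left
    multipliers, of determinants 1 and ['X^k]; its determinant is thus computed twice. *)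
Lemma char_poly_mulmxC n k (A : 'M[R]_(n, k)) (B : 'M[R]_(k, n)) :
  'X^k * char_poly (A *m B) = 'X^n * char_poly (B *m A).
Proof.
pose c (p q : nat) (Z : 'M[R]_(p, q)) := map_mx polyC Z.
pose M : 'M[{poly R}]_(n + k) := block_mx 'X%:M (c _ _ A) (c _ _ B) 1%:M.
have detL : \det M = char_poly (A *m B).
  have : \det (block_mx 1%:M (- c _ _ A) 0 1%:M *m M) = char_poly (A *m B).
    rewrite mulmx_block !mul1mx !mul0mx !add0r mulmx1 subrr det_lblock det1 mulr1.
    by rewrite /char_poly /char_poly_mx /c map_mxM mulNmx.
  by rewrite det_mulmx det_ublock !det1 !mul1r.
have detR : 'X^k * \det M = 'X^n * char_poly (B *m A).
  have : \det (block_mx 1%:M 0 (- c _ _ B) 'X%:M *m M) = 'X^n * char_poly (B *m A).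
    rewrite mulmx_block !mul1mx !mul0mx !addr0 mulmx1.
    rewrite mulNmx scalar_mxC mul_scalar_mx addNr det_ublock det_scalar.
    congr (_ * \det _).
    by rewrite /char_poly_mx /c map_mxM mulNmx addrC.
  by rewrite det_mulmx det_lblock det1 mul1r det_scalar.
by rewrite -detL.
Qed.

Lemma char_poly_neq0 n (A : 'M[R]_n) : char_poly A != 0.
Proof. exact: monic_neq0 (char_poly_monic A). Qed.

(** A rank factorisation writes [X^T X] as a product through dimension [\rank X]; exchanging the two
    factors exhibits the multiplicity of the root 0. *)
Lemma mup0_char_poly_gram m n (X : 'M[R]_(m, n)) :
  (n <= mup 0%R (char_poly (X^T *m X)) + \rank X)%N.
Proof.
have -> : X^T *m X = (row_base X)^T *m ((col_base X)^T *m X).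
  by rewrite mulmxA -trmx_mul mulmx_base.
set A := (row_base X)^T; set B := _ *m X.
have := congr1 (mup 0) (char_poly_mulmxC A B).
have X0 k : ('X^k : {poly R}) != 0 by rewrite monic_neq0 ?monicXn.
rewrite !mupM ?X0 ?char_poly_neq0 //.
have mX k : mup 0 ('X^k : {poly R}) = k.
  by have := @mup_XsubCX R k 0 0; rewrite subr0 eqxx.
by rewrite !mX addnC => ->; rewrite leq_addr.
Qed.

Lemma prod_mup_dvdp (p : {poly R}) (s : seq R) : p != 0 -> uniq s ->
  \prod_(x <- s) ('X - x%:P) ^+ mup x p %| p.
Proof.
move=> p0; elim: s => [|a s IH] /=; first by rewrite big_nil dvd1p.
case/andP => aNs us; rewrite big_cons Gauss_dvdp ?IH // -?mup_geq ?leqnn //.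
apply: coprimep_expl; rewrite coprimep_sym coprimep_XsubC.
rewrite /root horner_prod prodf_seq_neq0; apply/allP => x xs /=.
rewrite horner_exp hornerXsubC expf_neq0 // subr_eq0.
by apply: contraNneq aNs => ->.
Qed.

Lemma sum_mup_le (p : {poly R}) (s : seq R) : p != 0 -> uniq s ->
  (\sum_(x <- s) mup x p <= (size p).-1)%N.
Proof.
move=> p0 us; have := dvdp_leq p0 (prod_mup_dvdp p0 us).
rewrite size_prod_seq; last by move=> i _; rewrite expf_neq0 // polyXsubC_eq0.
under eq_bigr do rewrite size_exp_XsubC -addn1.
by rewrite big_split /= sum1_size -addSn addnK; case: (size p).
Qed.

(** The root 0 uses up at least [n - \rank X] of the at most [n] roots counted with multiplicity. *)
Lemma count_singular_values m n (X : 'M[R]_(m, n)) :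
  (count (fun y => (0 < y)%R) (singular_values X) <= \rank X)%N.
Proof.
rewrite /singular_values count_sort; set p := char_poly _.
have p0 : p != 0 := char_poly_neq0 _.
have -> s : count (fun y : R => 0 < y)
    (flatten [seq nseq (mup x p) (Num.sqrt x) | x <- s]) =
    (\sum_(x <- s | (0 < x)%R) mup x p)%N.
  elim: s => [|x s IH] /=; first by rewrite big_nil.
  by rewrite count_cat count_nseq sqrtr_gt0 IH big_cons; case: ifP => _; rewrite ?mul1n.
rewrite -big_filter -(leq_add2l (mup 0%R p)).
apply: leq_trans (mup0_char_poly_gram X).
have /= := @sum_mup_le p (0 :: [seq x <- rootsR p | 0 < x]) p0.
rewrite big_cons /= mem_filter ltxx filter_uniq ?uniq_roots //=.
by move=> /(_ isT); rewrite size_char_poly.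
Qed.

(** The entries up to the position of [Num.sqrt x] in the nonincreasing list are positive, so that
    position is within the first [\rank X]. This transfers a gap stated with [singular_value] to the
    [tau] of [rayleigh_min]. *)
Lemma singular_value_le m n (X : 'M[R]_(m, n)) (x : R) :
  0 < x -> root (char_poly (X^T *m X)) x ->
  singular_value (\rank X) X <= Num.sqrt x.
Proof.
move=> x0 px; rewrite /singular_value; set s := singular_values X.
have xs : Num.sqrt x \in s.
  rewrite mem_sort;
    apply/flattenP; exists (nseq (mup x (char_poly (X^T *m X))) (Num.sqrt x)).
    apply/mapP; exists x => //.
    by have := roots_on_rootsR (char_poly_neq0 (X^T *m X)) x; rewrite px in_itv.
  by rewrite mem_nseq eqxx andbT -XsubC_dvd ?char_poly_neq0 // dvdp_XsubCl.
have sorted_s : sorted (fun x y : R => y <= x) s.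
  by apply: sort_sorted => a b; rewrite le_total.
have leq_nth := sorted_leq_nth (fun a b c (h : a <= b) h' => le_trans h' h)
  (fun a : R => lexx a) 0 sorted_s.
set i := index (Num.sqrt x) s; have si : (i < size s)%N by rewrite index_mem.
have ni : nth 0 s i = Num.sqrt x by rewrite nth_index.
have i1 : (i.+1 <= \rank X)%N.
  apply: leq_trans (count_singular_values X); rewrite -/s.
  rewrite -(cat_take_drop i.+1 s) count_cat -[leqLHS]addn0 leq_add //.
  have -> : count (fun y => 0 < y) (take i.+1 s) = size (take i.+1 s).
    apply/eqP; rewrite -all_count; apply/(all_nthP 0) => j.
    rewrite size_takel // ltnS => ji; rewrite nth_take //.
    apply: (@lt_le_trans _ _ (Num.sqrt x)); first by rewrite sqrtr_gt0.
    rewrite -ni; apply: leq_nth => //; rewrite inE //.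
    exact: leq_ltn_trans si.
  by rewrite size_takel.
(* If the list is too short, [nth] returns its default 0, which is at most any square root. *)
have [sz|sz] := ltnP (\rank X).-1 (size s); last first.
  by rewrite nth_default // sqrtr_ge0.
rewrite -ni; apply: leq_nth => //.
by rewrite -ltnS prednK // (leq_trans _ i1).
Qed.

End SingularValues.

(** * Differentials and gradients of [f] and of its factored form *)

Lemma mulmx_is_bilinear (R : realType) m n p :
  bilinear_for (GRing.Scale.Law.clone _ _ *:%R _)
    (GRing.Scale.Law.clone _ _ *:%R _) (@mulmx R m n p).
Proof.
split=> [B|A] a X Y /=; first by rewrite mulmxDl -scalemxAl.
by rewrite mulmxDr -scalemxAr.
Qed.

HB.instance Definition _ (R : realType) m n p :=
  bilinear_isBilinear.Build R 'M[R]_(m, n) 'M[R]_(n, p) 'M[R]_(m, p)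
    _ _ (@mulmx R m n p) (@mulmx_is_bilinear R m n p).

Section MatrixDifferentials.
Context {R : realType}.

Lemma mulmx_continuous m n p :
  continuous (fun q : 'M[R]_(m, n) * 'M[R]_(n, p) => q.1 *m q.2).
Proof. by move=> q; apply: cvg_mulmx; [exact: cvg_fst|exact: cvg_snd]. Qed.

Global Instance is_diff_mulmx m n p (q : 'M[R]_(m, n) * 'M[R]_(n, p)) :
  is_diff q (fun q => q.1 *m q.2) (fun h => q.1 *m h.2 + h.1 *m q.2).
Proof.
apply: DiffDef; last by rewrite diff_bilin //; exact: mulmx_continuous.
by apply: differentiable_bilin; exact: mulmx_continuous.
Qed.

Lemma is_diff_linear (V W : normedModType R) (f : {linear V -> W}) (x : V) :
  continuous f -> is_diff x f f.
Proof.
move=> fc; apply: DiffDef; first exact: linear_differentiable.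
by rewrite diff_lin.
Qed.

Lemma trmx_continuous m n : continuous (@trmx R m n).
Proof.
move=> X; apply: (cvg_mx (F := nbhs X)) => i j; rewrite mxE; under eq_cvg do rewrite mxE.
exact: coord_continuous.
Qed.

Global Instance is_diff_trmx m n (X : 'M[R]_(m, n)) : is_diff X trmx trmx.
Proof. exact: is_diff_linear (@trmx_continuous m n). Qed.

Lemma is_derive_line (V W : normedModType R) (f : V -> W) (x v : V) (t : R) :
  differentiable f (x + t *: v) ->
  is_derive t (1 : R) (fun s => f (x + s *: v)) ('d f (x + t *: v) v).
Proof.
move=> df.
have dl : is_diff t (fun s : R => x + s *: v) (fun s => s *: v).
  by apply: is_diff_eq; rewrite add0r.
have dc : is_diff t (f \o (fun s : R => x + s *: v))
    ('d f (x + t *: v) \o (fun s => s *: v)).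
  by apply: is_diff_comp; apply: DiffDef.
apply: DeriveDef; first exact: diff_derivable.
by rewrite deriveE // diff_val /= scale1r.
Qed.

Lemma diff_min_eq0 (V : normedModType R) (f : V -> R) (x v : V) :
  (forall y, differentiable f y) -> (forall t : R, f x <= f (x + t *: v)) ->
  'd f x v = 0.
Proof.
move=> df fmin; have dl t := is_derive_line (x := x) (v := v) (t := t) (df _).
have -> : 'd f x v = 'd f (x + 0 *: v) v by rewrite scale0r addr0.
rewrite -(@derive_val _ _ _ _ _ _ _ (dl 0)).
have : is_derive (0 : R) (1 : R) (fun s : R => f (x + s *: v)) 0.
  apply: (@derive1_at_min _ _ (-1) 1).
  - exact: le_trans (lerN10 R) ler01.
  - by move=> t _.
  - by rewrite in_itv /= ltrN10 ltr01.
  - by move=> t _; rewrite scale0r addr0.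
by move=> h; rewrite (@derive_val _ _ _ _ _ _ _ h).
Qed.

(** The matrix is the Riesz representative of [h] for the trace inner product; this links the
    entrywise [grad] and [grad2] with differentials. *)
Lemma mxdot_linear_form m n (h : 'M[R]_(m, n) -> R) V :
  linear h -> mxdot (\matrix_(i, j) h (delta_mx i j)) V = h V.
Proof.
move=> hlin; pose hL : {linear 'M[R]_(m, n) -> R} :=
  HB.pack h (GRing.isLinear.Build _ _ _ _ _ hlin).
rewrite mxdotE -[RHS]/(hL V) {2}(matrix_sum_delta V) linear_sum.
apply: eq_bigr => i _; rewrite linear_sum; apply: eq_bigr => j _.
by rewrite linearZ /= mxE mulrC.
Qed.

Lemma mxdot_grad m n (f : 'M[R]_(m, n) -> R) X V :
  mxdot (grad f X) V = 'd f X V.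
Proof. by rewrite mxdot_linear_form // => a x y; rewrite linearP. Qed.

Lemma mxdot_grad2 m n r (g : 'M[R]_(m, r) * 'M[R]_(n, r) -> R) AB U V :
  mxdot (grad2 g AB).1 U + mxdot (grad2 g AB).2 V = 'd g AB (U, V).
Proof.
rewrite /= (@mxdot_linear_form _ _ (fun U => 'd g AB (U, 0))); last first.
  move=> a x y; rewrite -linearP; congr ('d g AB _).
  by apply/pair_eqP; rewrite /= scaler0 addr0 !eqxx.
rewrite (@mxdot_linear_form _ _ (fun V => 'd g AB (0, V))); last first.
  move=> a x y; rewrite -linearP; congr ('d g AB _).
  by apply/pair_eqP; rewrite /= scaler0 addr0 !eqxx.
rewrite -linearD; congr ('d g AB _).
by apply/pair_eqP; rewrite /= addr0 add0r !eqxx.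
Qed.

Lemma is_diff_fst (V W : normedModType R) (p : V * W) : is_diff p fst fst.
Proof. by apply: is_diff_linear => q; exact: cvg_fst. Qed.

Lemma is_diff_snd (V W : normedModType R) (p : V * W) : is_diff p snd snd.
Proof. by apply: is_diff_linear => q; exact: cvg_snd. Qed.

Lemma is_diff_mul_tr m n r (AB : 'M[R]_(m, r) * 'M[R]_(n, r)) :
  is_diff AB (fun AB => AB.1 *m AB.2^T)
    (fun UV => AB.1 *m UV.2^T + UV.1 *m AB.2^T).
Proof.
have d1 := is_diff_fst AB; have d2 := is_diff_snd AB.
have d3 : is_diff AB (trmx \o snd) (trmx \o snd) by exact: is_diff_comp.
have d4 := is_diff_pair d1 d3.
exact: (is_diff_comp d4 (is_diff_mulmx _)).
Qed.

Lemma is_diff_factored m n r (f : 'M[R]_(m, n) -> R)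
    (AB : 'M[R]_(m, r) * 'M[R]_(n, r)) :
  differentiable f (AB.1 *m AB.2^T) ->
  is_diff AB (factored f)
    (fun UV => 'd f (AB.1 *m AB.2^T) (AB.1 *m UV.2^T + UV.1 *m AB.2^T)).
Proof. by move=> df; exact: (is_diff_comp (is_diff_mul_tr AB) (differentiableP df)). Qed.

Lemma differentiable_mulmx (V : normedModType R) m n p (F : V -> 'M[R]_(m, n))
    (G : V -> 'M[R]_(n, p)) x :
  differentiable F x -> differentiable G x ->
  differentiable (fun y => F y *m G y) x.
Proof.
move=> dF dG.
have dp := is_diff_pair (differentiableP dF) (differentiableP dG).
by have [] := is_diff_comp dp (is_diff_mulmx _).
Qed.

Lemma differentiable_trmx (V : normedModType R) m n (F : V -> 'M[R]_(m, n)) x :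
  differentiable F x -> differentiable (fun y => (F y)^T) x.
Proof. by move=> dF; have [] := is_diff_comp (differentiableP dF) (is_diff_trmx _). Qed.

(** The differential at [(U, V)] is [<H, A V^T + U B^T> = <H B, U> + <H^T A, V>]. Pairing the
    difference of the two sides with itself, one component at a time, gives equality. *)
Lemma grad2_factored m n r (f : 'M[R]_(m, n) -> R)
    (AB : 'M[R]_(m, r) * 'M[R]_(n, r)) :
  differentiable f (AB.1 *m AB.2^T) ->
  grad2 (factored f) AB =
    (grad f (AB.1 *m AB.2^T) *m AB.2, (grad f (AB.1 *m AB.2^T))^T *m AB.1).
Proof.
move=> df; set H := grad f _.
have E U V : mxdot (grad2 (factored f) AB).1 U + mxdot (grad2 (factored f) AB).2 V
    = mxdot (H *m AB.2) U + mxdot (H^T *m AB.1) V.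
  rewrite mxdot_grad2; have := is_diff_factored df => dfac.
  rewrite diff_val /= -mxdot_grad mxdotDr addrC -/H.
  rewrite mxdot_mulr (mxdotC _ (AB.1 *m _)) mxdot_mull.
  by rewrite -[mxdot _ V]mxdot_tr trmx_mul trmxK (mxdotC V^T).
apply/pair_eqP/andP; split; rewrite -subr_eq0; apply/eqP/mxdot_eq0.
  have := E ((grad2 (factored f) AB).1 - H *m AB.2) 0.
  by rewrite !mxdot0r !addr0 => e; rewrite mxdotBl e subrr.
have := E 0 ((grad2 (factored f) AB).2 - H^T *m AB.1).
by rewrite !mxdot0r !add0r => e; rewrite mxdotBl e subrr.
Qed.

Lemma differentiable_grad2_factored m n r (f : 'M[R]_(m, n) -> R) AB :
  twice_differentiable f -> differentiable (grad2 (@factored R m n r f)) AB.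
Proof.
move=> hf.
have -> : grad2 (@factored R m n r f) = (fun AB =>
   (grad f (AB.1 *m AB.2^T) *m AB.2, (grad f (AB.1 *m AB.2^T))^T *m AB.1)).
  by apply/funext => CD; rewrite grad2_factored //; have [] := hf (CD.1 *m CD.2^T).
have dH : differentiable (fun AB : 'M[R]_(m, r) * 'M[R]_(n, r) =>
    grad f (AB.1 *m AB.2^T)) AB.
  have [_ dg] := hf (AB.1 *m AB.2^T).
  by have [] := is_diff_comp (is_diff_mul_tr AB) (differentiableP dg).
apply: differentiable_pair; apply: differentiable_mulmx => //.
- by have [] := is_diff_snd AB.
- exact: differentiable_trmx.
- by have [] := is_diff_fst AB.
Qed.

End MatrixDifferentials.

(** * From a second-order stationary point to the curvature inequality *)

Section SecondOrderStationarity.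
Context {R : realType}.

(** Near 0 the difference quotient exceeds [q - eps], hence [- eps]. With the mean value theorem
    this stands in for a second-order Taylor expansion. *)
Lemma derive_ge0_near (psi : R -> R) (q eps : R) :
  is_derive (0 : R) (1 : R) psi q -> psi 0 = 0 -> 0 <= q -> 0 < eps ->
  exists2 d : R, 0 < d & forall s, 0 < s < d -> - eps * s <= psi s.
Proof.
move=> [dpsi psiq] psi0 q0 eps0.
have /cvgrPdist_lt/(_ _ eps0) :
    h^-1 *: ((psi \o shift 0) (h *: 1) - psi 0) @[h --> 0^'] --> q.
  by rewrite -psiq; exact: dpsi.
move=> /nbhs_ballP[d /= d0 hd]; exists d => // s /andP[s0 sd].
have := hd s; rewrite /ball /= sub0r normrN gtr0_norm // => /(_ sd).
move=> /(_ (lt0r_neq0 s0)); rewrite psi0 subr0 /= addr0 [_ *: 1]mulr1 => h.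
have : q - s^-1 * psi s < eps by apply: le_lt_trans h; exact: ler_norm.
rewrite ltrBlDr -ltrBlDl -(ltr_pM2l s0) mulVKf ?gt_eqF // => h'.
have : 0 <= s * q by rewrite mulr_ge0 // ltW.
by nra.
Qed.

(** By contradiction, along the line [(A + t U, B + t V)]: for small [t > 0] the SOSP conditions
    make the change of [g] at least [- eps t^2], while RSM, available because the products stay in
    [D], makes it at most [t^2 (c + O(t))] with [c < 0]. *)
Lemma sosp_curvature m n r (f : 'M[R]_(m, n) -> R) (beta : R)
    (D : set 'M[R]_(m, n)) (A U : 'M[R]_(m, r)) (B V : 'M[R]_(n, r)) :
  twice_differentiable f -> relatively_open (@rank_le_set R m n r) D ->
  RSM beta f D -> D (A *m B^T) -> SOSP (factored f) (A, B) ->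
  0 <= 2 * mxdot (grad f (A *m B^T)) (U *m V^T)
    + beta * mxdot (A *m V^T + U *m B^T) (A *m V^T + U *m B^T).
Proof.
move=> hf [N [oN ->]] hRSM [NX _] [g0 hess].
set H := grad f _; set Del := A *m V^T + _; set W := U *m V^T.
rewrite leNgt; apply/negP => neg.
(* Half the expression assumed negative; also the [t^2] coefficient of the RSM bound, as the
   displacement is [t Del + t^2 W] and [<H, Del> = 0]. *)
pose c := mxdot H W + beta / 2 * mxdot Del Del.
have c0 : c < 0 by rewrite /c; lra.
pose g := @factored R m n r f.
pose line (s : R) : 'M[R]_(m, r) * 'M[R]_(n, r) := (A, B) + s *: (U, V).
pose psi s := 'd g (line s) (U, V).
have dg AB : differentiable g AB.
  by have [df _] := hf (AB.1 *m AB.2^T); have [] := is_diff_factored df.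
have dphi s : is_derive s (1 : R) (fun s => g (line s)) (psi s).
  exact: is_derive_line.
have psi0 : psi 0 = 0.
  rewrite /psi /line scale0r addr0 -mxdot_grad2 g0 /=.
  by rewrite mxdotC mxdot0r mxdotC mxdot0r addr0.
have dpsi : is_derive (0 : R) (1 : R) psi
   (mxdot U (hess2 g (A, B) (U, V)).1 + mxdot V (hess2 g (A, B) (U, V)).2).
  pose l (GH : 'M[R]_(m, r) * 'M[R]_(n, r)) := mxdot U GH.1 + mxdot V GH.2.
  have lin : linear l.
    by move=> a x y; rewrite /l /= !mxdotDr !mxdotZr scalerDr addrACA.
  pose L : {linear _ -> _} := HB.pack l (GRing.isLinear.Build _ _ _ _ _ lin).
  have Lc : continuous L.
    move=> x; apply: cvgD; apply: cvg_mxdot;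
      by [exact: cvg_cst|exact: cvg_fst|exact: cvg_snd].
  have dL (x : 'M[R]_(m, r) * 'M[R]_(n, r)) : is_diff x L L by exact: is_diff_linear.
  have dG : is_diff (A, B) (grad2 g) (hess2 g (A, B)).
    by apply: differentiableP; exact: differentiable_grad2_factored.
  have dLG := is_diff_comp dG (dL _).
  have -> : psi = (fun s => (L \o grad2 g) (line s)).
    by apply/funext => s; rewrite /psi -mxdot_grad2 /= /l (mxdotC U) (mxdotC V).
  have := @is_derive_line _ _ _ (L \o grad2 g) (A, B) (U, V) 0.
  by rewrite scale0r addr0 diff_val; apply; case: dLG.
(* As [c = - 3 eps], higher-order terms below [eps] leave an upper bound [- 2 eps], against the
   lower bound [- eps]. *)
pose eps := - c / 3; have eps0 : 0 < eps by rewrite /eps; lra.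
have [d d0 psi_ge] := derive_ge0_near dpsi psi0 (hess (U, V)) eps0.
pose a := beta * mxdot Del W; pose b := beta / 2 * mxdot W W.
(* For [0 < t < 1] the higher-order terms satisfy [a t + b t^2 <= k t]; the summand 1 keeps [k]
   positive. *)
pose k := 1 + `|a| + `|b|; have k0 : 0 < k by rewrite /k -addrA ltr_pwDl ?addr_ge0.
have cvgX : (line t).1 *m (line t).2^T @[t --> 0] --> A *m B^T.
  have cl p q (X Y : 'M[R]_(p, q)) : X + t *: Y @[t --> (0 : R)] --> X.
    have {2}-> : X = X + 0 *: Y by rewrite scale0r addr0.
    by apply: cvgD; [exact: cvg_cst|apply: cvgZr_tmp; exact: cvg_id].
  apply: cvg_mulmx; first exact: cl.
  apply: (@cvg_comp _ _ _ (fun t => B + t *: V) trmx _ (nbhs B)); first exact: cl.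
  exact: trmx_continuous.
near (0 : R)^'+ => t.
have t0 : 0 < t by near: t; exact: nbhs_right_gt.
have td : t < d by near: t; exact: nbhs_right_lt.
have t1 : t < 1 by near: t; exact: nbhs_right_lt.
have tk : t < eps / k by near: t; apply: nbhs_right_lt; rewrite divr_gt0.
have Nt : N ((line t).1 *m (line t).2^T).
  near: t; apply: (@cvg_at_right_filter _ _ _ 0 _ cvgX); exact: open_nbhs_nbhs.
have XE : (line t).1 *m (line t).2^T - A *m B^T = t *: Del + t ^+ 2 *: W.
  rewrite -[(line t).1]/(A + t *: U) -[(line t).2]/(B + t *: V).
  rewrite linearD linearZ /= mulmxDl !mulmxDr -!scalemxAl -!scalemxAr scalerA.
  by rewrite -expr2 scalerDr [LHS]addrC -[_ + (_ + _)]addrA addKr addrA.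
have Dt : (N `&` @rank_le_set R m n r) ((line t).1 *m (line t).2^T).
  by split=> //; exact: leq_trans (mxrankM_maxl _ _) (rank_leq_col _).
have DX : (N `&` @rank_le_set R m n r) (A *m B^T).
  by split=> //; exact: leq_trans (mxrankM_maxl _ _) (rank_leq_col _).
have := hRSM _ _ DX Dt; rewrite -/H frob_normK.
rewrite -[A *m B^T - _]opprB mxdotNl mxdotNr opprK XE.
have HDel : mxdot H Del = 0.
  have dfac := @is_diff_factored R m n r f (A, B) (hf _).1.
  by move: psi0; rewrite /psi /line scale0r addr0 diff_val /= -mxdot_grad.
rewrite mxdotDr !mxdotZr HDel mxdotDD !mxdotZl !mxdotZr.
have [s] : exists2 s, s \in `]0, t[%R & g (line t) - g (line 0) = psi s * (t - 0).
  apply: MVT => //; apply: derivable_within_continuous => x _.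
  by case: (dphi x).
rewrite in_itv /= subr0 => /andP[s0 st] gt.
have line0 : line 0 = (A, B) by rewrite /line scale0r addr0.
have := psi_ge s; rewrite s0 (lt_trans st td) => /(_ isT) ps.
have {}ps : - eps * t <= psi s.
  by apply: le_trans ps; rewrite !mulNr lerN2 ler_pM2l // ltW.
have {}gt : - eps * t ^+ 2 <= g (line t) - f (A *m B^T).
  by rewrite -[f _]/(g (A, B)) -line0 gt expr2 mulrA ler_pM2r.
move=> fX; have tt : 0 < t ^+ 2 by rewrite exprn_gt0.
have kt : t * k < eps by rewrite -ltr_pdivlMr.
have h1 : a * t <= `|a| * t by rewrite ler_pM2r // ler_norm.
have h2 : b * t ^+ 2 <= `|b| * t.
  apply: (@le_trans _ _ (`|b| * t ^+ 2)); first by rewrite ler_pM2r // ler_norm.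
  by rewrite ler_wpM2l // expr2 ger_pMl // ltW.
have h3 : a * t + b * t ^+ 2 < eps.
  apply: le_lt_trans (lerD h1 h2) _; apply: le_lt_trans kt.
  by rewrite /k !mulrDr mulr1 ![t * _]mulrC -addrA lerDr ltW.
have : - eps * t ^+ 2 <= t ^+ 2 * (c + (a * t + b * t ^+ 2)).
  apply: le_trans gt _; rewrite lerBlDl; apply: le_trans fX _.
  rewrite /c /a /b -addrA lerD2l le_eqVlt; apply/orP; left; apply/eqP.
  move: (mxdot H W) (mxdot Del Del) (mxdot Del W) (mxdot W W) => x1 x2 x3 x4.
  by field.
rewrite mulrC ler_pM2l // => h4.
have c3 : c = - 3 * eps by rewrite /eps; move: (c) => z; field.
move: (eps0) h3 h4; rewrite c3; move: (a * t + b * t ^+ 2) (eps) => x y.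
by clear; lra.
Unshelve. all: by end_near.
Qed.
End SecondOrderStationarity.

(** * First-order conditions, fixed points of PGD and their uniqueness *)

Section RankConstrainedStationarity.
Context {R : realType}.

(** With [G] the gradient, the lines [X + t G X^T X] and [X + t X X^T G] respect the rank
    constraint, and the derivatives along them are [|G X^T|^2] and [|X^T G|^2]. *)
Lemma argmin_grad_orthogonal m n r (f : 'M[R]_(m, n) -> R) X :
  (forall Y, differentiable f Y) -> is_argmin f (@rank_le_set R m n r) X ->
  grad f X *m X^T = 0 /\ (grad f X)^T *m X = 0.
Proof.
move=> df [/= rX minX]; have crit E :
    (forall t : R, (\rank (X + t *: E)%R <= r)%N) -> mxdot (grad f X) E = 0.
  by move=> rE; rewrite mxdot_grad; apply: diff_min_eq0 => // t; exact/minX/rE.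
split.
  apply: mxdot_eq0; rewrite mxdot_mulr trmxK; apply: crit => t.
  have -> : X + t *: (grad f X *m X^T *m X) = (1%:M + t *: (grad f X *m X^T)) *m X.
    by rewrite mulmxDl mul1mx -scalemxAl.
  exact: leq_trans (mxrankM_maxr _ _) rX.
apply: trmx_inj; rewrite trmx_mul trmxK trmx0.
apply: mxdot_eq0; rewrite mxdot_mull trmxK; apply: crit => t.
have -> : X + t *: (X *m (X^T *m grad f X)) = X *m (1%:M + t *: (X^T *m grad f X)).
  by rewrite mulmxDr mulmx1 -scalemxAr.
exact: leq_trans (mxrankM_maxl _ _) rX.
Qed.

Lemma argmin_grad_eq0 m n r (f : 'M[R]_(m, n) -> R) X :
  (forall Y, differentiable f Y) -> is_argmin f (@rank_le_set R m n r) X ->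
  (\rank X < r)%N -> grad f X = 0.
Proof.
move=> df [_ minX] rX; apply/matrixP => i j; rewrite !mxE.
apply: diff_min_eq0 => // t; apply: minX => /=.
apply: leq_trans (mxrank_add _ _) _; apply: leq_trans rX; rewrite -[leqRHS]addn1.
rewrite leq_add2l -[leqRHS](mxrank_delta R i j).
by apply: mxrankS; exact: scalemx_sub.
Qed.

Lemma pgd_fixed_pointP m n r (f : 'M[R]_(m, n) -> R) eta X :
  pgd_fixed_point r f eta X <->
  (\rank X <= r)%N /\ forall Y : 'M[R]_(m, n), (\rank Y <= r)%N ->
    0 <= 2 * eta * mxdot (grad f X) (Y - X) + mxdot (Y - X) (Y - X).
Proof.
have E Y : mxdot (Y - (X - eta *: grad f X)) (Y - (X - eta *: grad f X))
   = (2 * eta * mxdot (grad f X) (Y - X) + mxdot (Y - X) (Y - X))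
     + eta ^+ 2 * mxdot (grad f X) (grad f X).
  have -> : Y - (X - eta *: grad f X) = (Y - X) + eta *: grad f X.
    by rewrite opprB addrCA addrC.
  by rewrite mxdotDD mxdotZl !mxdotZr (mxdotC (Y - X) (grad f X)); ring.
have EX : mxdot (X - (X - eta *: grad f X)) (X - (X - eta *: grad f X))
    = eta ^+ 2 * mxdot (grad f X) (grad f X).
  by rewrite E subrr !mxdot0r mulr0 !add0r.
split=> -[rX h]; split=> // Y rY; have := h Y rY; rewrite /frob_norm.
  by rewrite ler_psqrt ?nnegrE ?mxdot_ge0 // EX E lerDr.
by move=> hY; rewrite ler_wsqrtr // EX E lerDr.
Qed.

Lemma row_space_singular m n (X : 'M[R]_(m, n)) : X != 0 ->
  exists (P : 'M[R]_n) (v : 'cV[R]_n) (tau : R),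
   [/\ [/\ P^T = P, P *m P = P, \tr P = (\rank X)%:R &
        forall G : 'M[R]_(m, n), G *m X^T = 0 -> G *m P = 0],
       [/\ mxdot v v = 1, 0 < tau & X^T *m (X *m v) = tau *: v] &
       forall w : 'cV[R]_n,
         tau * mxdot (P *m w) (P *m w) <= mxdot (X *m w) (X *m w)].
Proof.
move=> X0; have [P [symP idP XP trP PM]] := row_space_projector X.
have [v [tau [v1 tau0 Xv hX]]] := rayleigh_min symP idP XP PM X0.
exists P, v, tau; split=> //; split=> // G GX.
by have [M PE] := PM; rewrite -symP PE trmx_mul mulmxA GX mul0mx.
Qed.

Lemma proximal_of_spectral_gap m n (X G Y : 'M[R]_(m, n)) eta :
  G *m X^T = 0 -> G^T *m X = 0 -> (0 < \rank X)%N -> 0 <= eta ->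
  eta * spectral_norm G <= singular_value (\rank X) X ->
  (\rank Y <= \rank X)%N ->
  0 <= 2 * eta * mxdot G (Y - X) + mxdot (Y - X) (Y - X).
Proof.
move=> GX GtX rX eta0 gap rY.
have X0 : X != 0 by rewrite -mxrank_eq0 -lt0n.
have [P [v [tau [[symP idP trP GP] [v1 tau0 Xv] hX]]]] := row_space_singular X0.
apply: (@eckart_young _ _ _ _ _ _ P _ (spectral_norm G ^+ 2) tau) => //.
- exact: GP.
- by move=> w; exact: spectral_norm_mul.
- exact: sqr_ge0.
rewrite -exprMn -(sqr_sqrtr (ltW tau0)) lerXn2r ?nnegrE ?sqrtr_ge0 //.
  by rewrite mulr_ge0 ?spectral_norm_ge0.
(* [tau] is a positive eigenvalue of [X^T X], so its square root is at least the singular value in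
   [gap]. *)
apply: le_trans gap (singular_value_le tau0 _).
rewrite -eigenvalue_root_char; apply/eigenvalueP; exists v^T.
  apply: trmx_inj; rewrite trmx_mul trmxK linearZ /= trmxK -Xv.
  by rewrite trmx_mul trmxK mulmxA.
apply: contra_eqN v1 => /eqP/(congr1 trmx); rewrite trmxK trmx0 => ->.
by rewrite mxdot0r eq_sym oner_eq0.
Qed.

Lemma row_free_ker0 p q (M : 'M[R]_(p, q)) : ~~ row_free M ->
  exists2 w : 'cV[R]_p, w != 0 & M^T *m w = 0.
Proof.
rewrite -kermx_eq0 => /rowV0Pn[u uK u0]; exists u^T.
  by apply: contraNneq u0 => /(congr1 trmx); rewrite trmxK trmx0 => ->.
by rewrite -trmx_mul (sub_kermxP uK) trmx0.
Qed.

Lemma mx_eq0_bilinear m n (H : 'M[R]_(m, n)) :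
  (forall (a : 'cV[R]_m) (b : 'cV[R]_n), mxdot H (a *m b^T) = 0) -> H = 0.
Proof.
move=> h; apply: mxdot_eq0; rewrite -[H]mulmx1 mxdot_col big1 // => j _.
by rewrite mxdot_mulr.
Qed.

(** Some [w != 0] satisfies [B w = 0] or [A w = 0]. If [B w = 0], then [U = a w^T] and [V = t b w^T]
    give [U B^T = 0] and [U V^T = t |w|^2 a b^T]: a nonnegative quadratic in [t] without constant
    term. The other case is symmetric. *)
Lemma curvature_rank_deficient m n r (H : 'M[R]_(m, n)) (A : 'M[R]_(m, r))
    (B : 'M[R]_(n, r)) beta :
  (forall U V, 0 <= 2 * mxdot H (U *m V^T)
     + beta * mxdot (A *m V^T + U *m B^T) (A *m V^T + U *m B^T)) ->
  (\rank (A *m B^T) < r)%N -> H = 0.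
Proof.
move=> curv rAB; apply: mx_eq0_bilinear => a b.
have [freeB|/row_free_ker0[w w0]] := boolP (row_free B^T); last first.
  rewrite trmxK => Bw.
  have /eqP : 2 * mxdot w w * mxdot H (a *m b^T) = 0.
    apply: (@quadratic_ge0_linear_coef _ _
      (beta * mxdot (A *m w *m b^T) (A *m w *m b^T))) => t.
    have := curv (a *m w^T) (t *: (b *m w^T)).
    have -> : a *m w^T *m B^T = 0 by rewrite -mulmxA -trmx_mul Bw trmx0 mulmx0.
    rewrite addr0 linearZ /= trmx_mul trmxK -!scalemxAr !mulmxA.
    rewrite -[a *m w^T *m w]mulmxA mxdot_cV mul_mx_scalar -scalemxAl.
    by rewrite !mxdotZl !mxdotZr => h; lra.
  by rewrite !mulf_eq0 pnatr_eq0 /= gt_eqF ?mxdot_gt0 //= => /eqP.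
have : ~~ row_free A^T.
  by rewrite /row_free mxrank_tr -(mxrankMfree A freeB) ltn_eqF.
move=> /row_free_ker0[w w0]; rewrite trmxK => Aw.
have /eqP : 2 * mxdot w w * mxdot H (a *m b^T) = 0.
  apply: (@quadratic_ge0_linear_coef _ _
    (beta * mxdot (a *m (B *m w)^T) (a *m (B *m w)^T))) => t.
  have := curv (t *: (a *m w^T)) (b *m w^T).
  have -> : A *m (b *m w^T)^T = 0 by rewrite trmx_mul trmxK mulmxA Aw mul0mx.
  rewrite add0r trmx_mul trmxK -!scalemxAl -[a *m w^T *m B^T]mulmxA -trmx_mul !mulmxA.
  rewrite -[a *m w^T *m w]mulmxA mxdot_cV mul_mx_scalar -scalemxAl.
  by rewrite !mxdotZl !mxdotZr => h; lra.
by rewrite !mulf_eq0 pnatr_eq0 /= gt_eqF ?mxdot_gt0 //= => /eqP.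
Qed.

(* The test directions are built from a unit right singular vector [v] of
   [A *m B^T] with the least nonzero singular value [Num.sqrt tau]: with
   [q = A^T X v / tau] and [p = B^T v] one gets [B q = v], [A p = X v] and
   [q^T p = 1]. *)
Lemma curvature_full_rank m n r (H : 'M[R]_(m, n)) (A : 'M[R]_(m, r))
    (B : 'M[R]_(n, r)) beta tau (v : 'cV[R]_n) (b : 'cV[R]_n) :
  (forall U V, 0 <= 2 * mxdot H (U *m V^T)
     + beta * mxdot (A *m V^T + U *m B^T) (A *m V^T + U *m B^T)) ->
  0 < beta -> H^T *m (A *m B^T) = 0 -> mxdot v v = 1 -> 0 < tau ->
  (A *m B^T)^T *m (A *m B^T *m v) = tau *: v ->
  mxdot (H *m b) (H *m b) <= beta ^+ 2 * tau * mxdot b b.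
Proof.
move=> curv beta0 HX v1 tau0 Xv.
pose q := tau^-1 *: (A^T *m (A *m B^T *m v)); pose p := B^T *m v.
have Bq : B *m q = v.
  have BA : B *m A^T = (A *m B^T)^T by rewrite trmx_mul trmxK.
  by rewrite /q -scalemxAr [B *m _]mulmxA BA Xv scalerA mulVf ?gt_eqF // scale1r.
have Ap : A *m p = A *m B^T *m v by rewrite mulmxA.
have XvXv : mxdot (A *m B^T *m v) (A *m B^T *m v) = tau.
  by rewrite mxdot_mull Xv mxdotZr v1 mulr1.
have qp : mxdot q p = 1.
  by rewrite mxdotC /p mxdot_mull trmxK Bq.
(* This [a] minimises [2 <H, a b^T> + beta |a|^2]. *)
pose a := - beta^-1 *: (H *m b).
have := curv (a *m q^T) (b *m p^T).
have -> : A *m (b *m p^T)^T = A *m B^T *m v *m b^T.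
  by rewrite trmx_mul trmxK mulmxA Ap.
have -> : a *m q^T *m B^T = a *m v^T by rewrite -mulmxA -trmx_mul Bq.
have -> : a *m q^T *m (b *m p^T)^T = a *m b^T.
  rewrite trmx_mul trmxK mulmxA -[a *m q^T *m p]mulmxA mxdot_cV qp mul_mx_scalar.
  by rewrite scale1r.
have au : mxdot (A *m B^T *m v) a = 0.
  by rewrite /a mxdotZr mxdotC mxdot_mull mulmxA HX mul0mx mxdot0r mulr0.
rewrite mxdotDD !mxdot_outer au XvXv v1 mulr1 mul0r mulr0 addr0.
have -> : mxdot H (a *m b^T) = - beta^-1 * mxdot (H *m b) (H *m b).
  by rewrite -mxdot_mulr mxdotZr.
rewrite /a mxdotZl mxdotZr; move: (mxdot _ (H *m b)) (mxdot b b) => x y h.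
have : beta * (2 * (- beta^-1 * x) + beta * (tau * y + - beta^-1 * (- beta^-1 * x)))
   = beta ^+ 2 * tau * y - x by field; rewrite gt_eqF.
by move=> e; rewrite -subr_ge0 -e mulr_ge0 // ltW.
Qed.

Lemma sosp_pgd_fixed_point m n r (f : 'M[R]_(m, n) -> R) beta
    (D : set 'M[R]_(m, n)) (A : 'M[R]_(m, r)) (B : 'M[R]_(n, r)) :
  (0 < r)%N -> twice_differentiable f ->
  relatively_open (@rank_le_set R m n r) D ->
  RSM beta f D -> 0 < beta -> D (A *m B^T) -> SOSP (factored f) (A, B) ->
  pgd_fixed_point r f beta^-1 (A *m B^T).
Proof.
move=> r0 hf hD hRSM beta0 DX sosp; apply/pgd_fixed_pointP.
have curv U V := @sosp_curvature _ _ _ _ _ _ _ _ U _ V hf hD hRSM DX sosp.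
have rAB : (\rank (A *m B^T) <= r)%N.
  exact: leq_trans (mxrankM_maxl _ _) (rank_leq_col _).
split=> // Y rY; move: rAB; rewrite leq_eqVlt => /orP[/eqP rX|rX]; last first.
  rewrite (curvature_rank_deficient curv rX) mxdotC mxdot0r mulr0 add0r.
  exact: mxdot_ge0.
have [g0 _] := sosp; have [df _] := hf (A *m B^T).
move: g0; rewrite grad2_factored //= => -[HB HA].
have HX : grad f (A *m B^T) *m (A *m B^T)^T = 0.
  by rewrite trmx_mul trmxK mulmxA HB mul0mx.
have HtX : (grad f (A *m B^T))^T *m (A *m B^T) = 0 by rewrite mulmxA HA mul0mx.
have X0 : A *m B^T != 0 by rewrite -mxrank_eq0 rX -lt0n.
have [P [v [tau [[symP idP trP HP] [v1 tau0 Xv] hX]]]] := row_space_singular X0.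
(* The curvature bound supplies [gam = beta^2 tau], for which [eta^2 gam <= tau] is an equality at
   [eta = 1 / beta]. *)
apply: (@eckart_young _ _ _ _ _ _ P _ (beta ^+ 2 * tau) tau) => //.
- exact: HP.
- by move=> b; exact: (curvature_full_rank b curv beta0 HtX v1 tau0 Xv).
- by rewrite mulr_ge0 ?sqr_ge0 // ltW.
- by rewrite mulrA exprVn mulVf ?mul1r // expf_neq0 // gt_eqF.
- by rewrite rX.
Qed.

(** RSC and RSM are compared at two distinct points of [D]. Together with [beta < 2 * alpha] this
    yields the positivity of both constants. *)
Lemma restricted_constants_le m n r (f : 'M[R]_(m, n) -> R) alpha beta
    (D : set 'M[R]_(m, n)) X :
  (0 < m)%N -> (0 < n)%N -> (0 < r)%N ->
  relatively_open (@rank_le_set R m n r) D -> RSC alpha f D -> RSM beta f D ->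
  D X -> alpha <= beta.
Proof.
move=> m0 n0 r0 [N [oN ->]] rsc rsm [NX rX].
(* A direction that keeps the rank at most [r]: [X] itself if nonzero, otherwise a matrix unit, as
   [r >= 1]. *)
have [E E0 rE] : exists2 E, E != 0 & forall t : R, (\rank (X + t *: E)%R <= r)%N.
  have [X0|X0] := eqVneq X 0; last first.
    exists X => // t; rewrite -[X in X + t *: _]scale1r -scalerDl.
    by apply: leq_trans rX; apply: mxrankS; exact: scalemx_sub.
  exists (delta_mx (Ordinal m0) (Ordinal n0)).
    by rewrite -mxrank_eq0 mxrank_delta.
  move=> t; rewrite X0 add0r; apply: leq_trans r0.
  rewrite -[leqRHS](mxrank_delta R (Ordinal m0) (Ordinal n0)).
  by apply: mxrankS; exact: scalemx_sub.
have cX : X + t *: E @[t --> (0 : R)] --> X.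
  have {2}-> : X = X + 0 *: E by rewrite scale0r addr0.
  by apply: cvgD; [exact: cvg_cst|apply: cvgZr_tmp; exact: cvg_id].
have [t t0 Nt] : exists2 t : R, 0 < t & N (X + t *: E).
  near (0 : R)^'+ => t; exists t; first by near: t; exact: nbhs_right_gt.
  near: t; apply: (@cvg_at_right_filter _ _ _ 0 _ cX); exact: open_nbhs_nbhs.
have DX : (N `&` @rank_le_set R m n r) X by [].
have DY : (N `&` @rank_le_set R m n r) (X + t *: E) by split=> //; exact: rE.
have := le_trans (rsc _ _ DX DY) (rsm _ _ DX DY).
rewrite lerD2l frob_normK ler_pM2r ?ler_pM2r ?invr_gt0 //.
rewrite mxdot_gt0 // subr_eq0 eq_sym -subr_eq0 addrC addKr.
by rewrite scaler_eq0 negb_or gt_eqF.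
Unshelve. all: by end_near. Qed.

(** RSC in both directions and the proximal inequalities, with constants [1 / eta] at [X] and [c] at
    [Xhat], add up to [(2 alpha - (c + 1 / eta)) |X - Xhat|^2 <= 0]. *)
Lemma proximal_point_unique m n r (f : 'M[R]_(m, n) -> R) alpha eta c
    (D : set 'M[R]_(m, n)) X Xhat :
  RSC alpha f D -> D X -> D Xhat -> (\rank Xhat <= r)%N -> 0 < eta ->
  c + eta^-1 < 2 * alpha -> pgd_fixed_point r f eta X ->
  0 <= 2 * mxdot (grad f Xhat) (X - Xhat) + c * mxdot (X - Xhat) (X - Xhat) ->
  X = Xhat.
Proof.
move=> rsc DX DXh rXh eta0 hc /pgd_fixed_pointP[_ /(_ _ rXh)] hX hXh.
have h1 := rsc _ _ DX DXh; have h2 := rsc _ _ DXh DX.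
rewrite !frob_normK in h1 h2.
have NE : mxdot (Xhat - X) (Xhat - X) = mxdot (X - Xhat) (X - Xhat).
  by rewrite -[Xhat - X]opprB mxdotNl mxdotNr opprK.
rewrite NE in hX h2.
apply/eqP; rewrite -subr_eq0; apply/eqP/mxdot_eq0; apply/eqP.
rewrite eq_le mxdot_ge0 andbT.
have {hX} :
    0 <= 2 * mxdot (grad f X) (Xhat - X) + eta^-1 * mxdot (X - Xhat) (X - Xhat).
  rewrite -(pmulr_rge0 _ eta0) mulrDr mulrA [eta * 2]mulrC mulVKf // gt_eqF //.
set x := mxdot (X - Xhat) (X - Xhat) in h1 h2 hXh *.
set gX := mxdot (grad f X) (Xhat - X) in h1 *.
set gXh := mxdot (grad f Xhat) (X - Xhat) in h2 hXh *.
move: h1 h2 hXh hc; clearbody x gX gXh; move: (f X) (f Xhat) eta^-1.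
move=> fX fXh e h1 h2 h3 h4 h5.
have : (2 * alpha - (c + e)) * x <= 0 by lra.
by rewrite pmulr_rle0 // subr_gt0.
Qed.

End RankConstrainedStationarity.

(** * Admissible step sizes, uniqueness at each of them, and the case of a SOSP *)

Theorem theorem2 (R : realType) (m n r : nat)
    (hm : (0 < m)%N) (hn : (0 < n)%N) (hr : (0 < r)%N) (hrmn : (r <= minn m n)%N)
    (f : 'M[R]_(m, n) -> R) (hf : twice_differentiable f)
    (alpha beta : R) (D : set 'M[R]_(m, n))
    (hD : relatively_open (@rank_le_set R m n r) D)
    (hRSC : RSC alpha f D) (hRSM : RSM beta f D) (hab : beta < 2 * alpha)
    (Xhat : 'M[R]_(m, n))
    (hmin : is_argmin f (@rank_le_set R m n r) Xhat)
    (hXD : D Xhat)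
    (hX : (\rank Xhat < r)%N \/
          (\rank Xhat = r /\
           spectral_norm (grad f Xhat)
             < (2 * alpha - beta) * singular_value r Xhat)) :
  (forall eta : R,
     (((\rank Xhat < r)%N /\ 1 / (2 * alpha) < eta /\ eta <= 1 / beta) \/
      (\rank Xhat = r /\
       1 / (2 * alpha - spectral_norm (grad f Xhat) / singular_value r Xhat)
         < eta /\ eta <= 1 / beta)) ->
     pgd_fixed_point r f eta Xhat /\
     forall X : 'M[R]_(m, n), D X -> pgd_fixed_point r f eta X -> X = Xhat)
  /\
  (forall (A : 'M[R]_(m, r)) (B : 'M[R]_(n, r)),
     D (A *m B^T) -> SOSP (factored f) (A, B) -> A *m B^T = Xhat).
Proof.
have df X : differentiable f X by have [] := hf X.
have ab : alpha <= beta := restricted_constants_le hm hn hr hD hRSC hRSM hXD.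
have a0 : 0 < alpha by lra.
have b0 : 0 < beta by lra.
have a20 : 0 < 2 * alpha by lra.
have ab0 : 0 < 2 * alpha - beta by lra.
have [/= rXhat _] := hmin.
have rD X : D X -> (\rank X <= r)%N by case: hD => N [_ ->] [].
have [GX GtX] := argmin_grad_orthogonal df hmin.
(* The proximal inequality at [Xhat]; for [eta > 0], [gap eta^-1] says that [Xhat] is a fixed point
   at step size [eta]. *)
pose gap (c : R) := forall Y : 'M[R]_(m, n), (\rank Y <= r)%N ->
  0 <= 2 * mxdot (grad f Xhat) (Y - Xhat) + c * mxdot (Y - Xhat) (Y - Xhat).
have gap_low : (\rank Xhat < r)%N -> forall c, 0 <= c -> gap c.
  move=> rX c c0 Y _; rewrite (argmin_grad_eq0 df hmin rX) mxdotC mxdot0r mulr0.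
  by rewrite add0r mulr_ge0 ?mxdot_ge0.
have gap_full : \rank Xhat = r -> forall c, 0 < c ->
    spectral_norm (grad f Xhat) <= c * singular_value r Xhat -> gap c.
  move=> rX c c0 hc Y rY; have ci0 : 0 <= c^-1 by rewrite invr_ge0 ltW.
  have hc' : c^-1 * spectral_norm (grad f Xhat) <= singular_value (\rank Xhat) Xhat.
    by rewrite rX ler_pdivrMl.
  have rX0 : (0 < \rank Xhat)%N by rewrite rX.
  have rY' : (\rank Y <= \rank Xhat)%N by rewrite rX.
  have := proximal_of_spectral_gap GX GtX rX0 ci0 hc' rY'.
  by rewrite -(pmulr_rge0 _ c0) mulrDr mulrA [2 * _]mulrC mulrA divff ?gt_eqF // mul1r.
have stepP (x eta : R) : 0 < x -> 1 / x < eta -> 0 < eta /\ eta^-1 < x.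
  rewrite div1r => x0 xeta; have eta0 : 0 < eta.
    by apply: lt_trans xeta; rewrite invr_gt0.
  by rewrite -[x]invrK ltf_pV2 // posrE invr_gt0.
pose admissible (eta : R) :=
  ((\rank Xhat < r)%N /\ 1 / (2 * alpha) < eta /\ eta <= 1 / beta) \/
   (\rank Xhat = r /\
    1 / (2 * alpha - spectral_norm (grad f Xhat) / singular_value r Xhat)
      < eta /\ eta <= 1 / beta).
have step_gap eta : admissible eta ->
    [/\ 0 < eta, gap eta^-1 & exists2 c, c + eta^-1 < 2 * alpha & gap c].
  case=> -[rX [eta_gt eta_le]].
    have [eta0 etai] := stepP _ _ a20 eta_gt.
    split=> //; first by apply: gap_low; rewrite // invr_ge0 ltW.
    (* The midpoint of 0 and [2 * alpha - eta^-1]. *)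
    exists ((2 * alpha - eta^-1) / 2); first lra.
    by apply: gap_low => //; lra.
  case: hX => [|[_ hsp]]; first by rewrite rX ltnn.
  have sp0 := spectral_norm_ge0 (grad f Xhat).
  set sp := spectral_norm _ in hsp sp0 eta_gt gap_full.
  set sg := singular_value _ _ in hsp eta_gt gap_full.
  (* Forced by the strict spectral bound, so that [sp / sg] is a genuine quotient. *)
  have sg0 : 0 < sg.
    by rewrite -(pmulr_rgt0 _ ab0) (le_lt_trans sp0).
  have rho0 : 0 <= sp / sg by rewrite divr_ge0 // ltW.
  have rho_lt : sp / sg < 2 * alpha - beta by rewrite ltr_pdivrMr.
  have spE c : (sp <= c * sg) = (sp / sg <= c) by rewrite ler_pdivrMr.
  move: (sp / sg) rho0 rho_lt spE eta_gt => rho rho0 rho_lt spE eta_gt.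
  have rho_pos : 0 < 2 * alpha - rho by lra.
  have [eta0 etai] := stepP _ _ rho_pos eta_gt.
  (* Since [alpha <= beta], one has [rho < 2 alpha - beta <= beta <= 1 / eta], which yields
     [gap eta^-1]. *)
  have beta_le : beta <= eta^-1.
    by rewrite -[beta]invrK lef_pV2 ?posrE ?invr_gt0 // -div1r.
  split=> //.
    by apply: gap_full; rewrite ?invr_gt0 // spE; lra.
  (* The midpoint of [rho] and [2 * alpha - eta^-1]. *)
  exists ((rho + 2 * alpha - eta^-1) / 2); first lra.
  by apply: gap_full; rewrite ?spE //; lra.
have uniq eta X : admissible eta ->
    D X -> pgd_fixed_point r f eta X -> X = Xhat.
  move=> /step_gap[eta0 _ [c hc gapc]] DX fixX.
  exact: proximal_point_unique hRSC DX hXD rXhat eta0 hc fixX (gapc _ (rD _ DX)).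
split=> [eta heta|A B DX sosp].
  split=> [|X]; last exact: uniq.
  have [eta0 gape _] := step_gap _ heta.
  apply/pgd_fixed_pointP; split=> // Y rY; have := gape Y rY.
  by rewrite -(pmulr_rge0 _ eta0) mulrDr mulrCA mulrA mulVKf ?gt_eqF //.
(* Step size [1 / beta] is admissible: the lower bounds amount to [beta < 2 * alpha] and to the
   strict spectral bound in [hX]. *)
apply: (uniq beta^-1) => //; last exact: (sosp_pgd_fixed_point hr hf hD hRSM b0 DX sosp).
rewrite /admissible !div1r !lexx; case: hX => [rX|[rX hsp]]; [left|right]; do 2!split=> //.
  by rewrite ltf_pV2.
have sp0 := spectral_norm_ge0 (grad f Xhat).
have sg0 : 0 < singular_value r Xhat by rewrite -(pmulr_rgt0 _ ab0) (le_lt_trans sp0).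
have rho_lt : spectral_norm (grad f Xhat) / singular_value r Xhat < 2 * alpha - beta.
  by rewrite ltr_pdivrMr.
by rewrite ltf_pV2 ?posrE //; lra.
Qed.
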